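(* Let $\Lambda$ be a row-finite $k$-graph with no sources. Then the map $$\phi:\mathscr M(\Lambda)\longrightarrow \operatorname{Spec}_{\mathbb Z^k}(T_\Lambda),\qquad M\longmapsto J_{\Lambda^0\setminus M}$$ is an anti-isomorphism of posets (order-reversing bijection) with inverse given by $$\psi:\operatorname{Spec}_{\mathbb Z^k}(T_\Lambda)\longrightarrow\mathscr M(\Lambda),\qquad J\longmapsto \Lambda^0\setminus H_J.$$
   Context: $k\ge1$ is an integer, $\mathbb N\ni0$, $\mathbf e_1,\dots,\mathbf e_k$ are the standard generators of $\mathbb N^k$. A $k$-graph is a countable small category $\Lambda$ with a functor $d:\Lambda\to\mathbb N^k$ such that whenever $d(\lambda)=\mathbf m+\mathbf n$ there are unique $\alpha,\beta$ with $d(\alpha)=\mathbf m$, $d(\beta)=\mathbf n$, $\lambda=\alpha\beta$. Objects are identified with $\Lambda^0=d^{-1}(0)$; $r(\lambda),s(\lambda)$ are the codomain and domain of $\lambda$; $v\Lambda^{\mathbf n}=\{\lambda: d(\lambda)=\mathbf n,\ r(\lambda)=v\}$; $v\Lambda w=\{\lambda: r(\lambda)=v,\ s(\lambda)=w\}$. $\Lambda$ is row-finite if every $v\Lambda^{\mathbf n}$ is finite, and without sources if every $v\Lambda^{\mathbf n}$ is nonempty. A nonempty $M\subseteq\Lambda^0$ is a maximal tail if: (MT1) $w\in M$, $v\in\Lambda^0$, $v\Lambda w\ne\emptyset$ imply $v\in M$; (MT2) for $v\in M$ and $1\le i\le k$ there is $\lambda\in v\Lambda^{\mathbf e_i}$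 with $s(\lambda)\in M$; (MT3) for $u,v\in M$ there is $w\in M$ with $u\Lambda w\ne\emptyset$ and $v\Lambda w\neq\emptyset$. $\mathscr M(\Lambda)$ is the set of maximal tails ordered by inclusion. The talented monoid $T_\Lambda$ is the commutative monoid generated by symbols $v(\mathbf n)$ ($v\in\Lambda^0$, $\mathbf n\in\mathbb Z^k$) subject to $v(\mathbf n)=\sum_{\alpha\in v\Lambda^{\mathbf m}}s(\alpha)(\mathbf n+\mathbf m)$ for all $v\in\Lambda^0,\mathbf n\in\mathbb Z^k,\mathbf m\in\mathbb N^k$, with $\mathbb Z^k$ acting by ${}^{\mathbf q}v(\mathbf n)=v(\mathbf n+\mathbf q)$. The algebraic preorder is $x\le y$ iff $y=x+z$ for some $z$. A $\mathbb Z^k$-order ideal is a submonoid that is a down-set for $\le$ and closed under $\mathbb Z^k$. A proper $\mathbb Z^k$-order ideal $P$ is prime if for $\mathbb Z^k$-order ideals $J_1,J_2$, $J_1\cap J_2\subseteq P$ implies $J_1\subseteq P$ or $J_2\subseteq P$; $\operatorname{Spec}_{\mathbb Z^k}(T_\Lambda)$ is the set of these, ordered by inclusion. For $H\subseteq\Lambda^0$, $J_H$ is the $\mathbb Z^k$-order ideal of $T_\Lambda$ generated by $\{v(0):v\in H\}$; for a $\mathbb Z^k$-order ideal $J$, $H_J:=\{v\in\Lambda^0: v(0)\in J\}$. *)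

(* Defs.v *)
From HB Require Import structures.
From mathcomp Require Import all_boot all_order all_algebra.
From mathcomp Require Import finmap all_classical.

Set Implicit Arguments.
Unset Strict Implicit.
Unset Printing Implicit Defensive.

Import GRing.Theory.
Local Open Scope ring_scope.
Local Open Scope classical_set_scope.
Local Open Scope quotient_scope.

(* A countable small category, with [cmpm a b] the composite "first b, then a".
   [cmpm] is total, but its value is meaningful only when [src a = rng b]: every
   axiom about it is guarded by composability.  The objects are identified with
   the paths of degree 0 through [idm]. *)
Record kgraph (k : nat) := KGraph {
  vert : countType;
  mor : countType;
  rng : mor -> vert;
  src : mor -> vert;
  idm : vert -> mor;
  cmpm : mor -> mor -> mor;
  deg : mor -> 'rV[nat]_k;
  rng_idm : forall v, rng (idm v) = v;
  src_idm : forall v, src (idm v) = v;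
  rng_cmpm : forall a b, src a = rng b -> rng (cmpm a b) = rng a;
  src_cmpm : forall a b, src a = rng b -> src (cmpm a b) = src b;
  cmpmA : forall a b c, src a = rng b -> src b = rng c ->
    cmpm a (cmpm b c) = cmpm (cmpm a b) c;
  cmpm_idl : forall a, cmpm (idm (rng a)) a = a;
  cmpm_idr : forall a, cmpm a (idm (src a)) = a;
  deg_idm : forall v, deg (idm v) = 0;
  deg_cmpm : forall a b, src a = rng b -> deg (cmpm a b) = deg a + deg b;
  factorization : forall (l : mor) (m n : 'rV[nat]_k), deg l = m + n ->
    exists! p : mor * mor,
      [/\ src p.1 = rng p.2, deg p.1 = m, deg p.2 = n & l = cmpm p.1 p.2]
}.

Section KGraphTheory.
Variables (k : nat) (L : kgraph k).

(* v Λ^n *)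
Definition paths_from (v : vert L) (n : 'rV[nat]_k) : set (mor L) :=
  [set a | deg a = n /\ rng a = v].

(* v Λ w *)
Definition paths_between (v w : vert L) : set (mor L) :=
  [set a | rng a = v /\ src a = w].

Definition row_finite : Prop := forall v n, finite_set (paths_from v n).

Definition no_sources : Prop := forall v n, paths_from v n !=set0.

Definition maximal_tail (M : set (vert L)) : Prop :=
  [/\ M !=set0,
      (forall w v, M w -> paths_between v w !=set0 -> M v),
      (forall v (i : 'I_k), M v ->
         exists2 a, paths_from v (delta_mx 0 i) a & M (src a))
    & (forall u v, M u -> M v ->
         exists2 w, M w & paths_between u w !=set0 /\ paths_between v w !=set0)].

Definition maximal_tails : set (set (vert L)) := [set M | maximal_tail M].

(* The talented monoid is the quotient of the monoid of words in the symbols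
   v(n), encoded as pairs (v, n), by the least congruence that identifies words
   equal up to reordering and contains the defining relations. *)
Definition word := seq (vert L * 'rV[int]_k).

Definition zvec (m : 'rV[nat]_k) : 'rV[int]_k := map_mx Posz m.

(* The word s(a_1)(n) ... s(a_j)(n) for l = [:: a_1; ...; a_j]. *)
Definition src_word (l : seq (mor L)) (n : 'rV[int]_k) : word :=
  [seq (src a, n) | a <- l].

(* In [Tcong_rel] the list l enumerates v Λ^m without repetition; if v Λ^m is
   infinite there is no such list, hence no relation. *)
Inductive Tcong : word -> word -> Prop :=
| Tcong_perm s t : perm_eq s t -> Tcong s t
| Tcong_rel v n m l : uniq l -> [set` l] = paths_from v m ->
    Tcong [:: (v, n)] (src_word l (n + zvec m))
| Tcong_cat s s' t t' : Tcong s s' -> Tcong t t' -> Tcong (s ++ t) (s' ++ t')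
| Tcong_sym s t : Tcong s t -> Tcong t s
| Tcong_trans s t u : Tcong s t -> Tcong t u -> Tcong s u.

Definition Tcongb : rel word := fun s t => `[< Tcong s t >].

Lemma Tcongb_refl : reflexive Tcongb.
Proof. by move=> s; apply/asboolP/Tcong_perm. Qed.

Lemma Tcongb_sym : symmetric Tcongb.
Proof. by move=> s t; apply/asboolP/asboolP => /Tcong_sym. Qed.

Lemma Tcongb_trans : transitive Tcongb.
Proof.
by move=> s t u /asboolP ts /asboolP su; apply/asboolP; apply: Tcong_trans su.
Qed.

Canonical Tcong_equiv := EquivRel Tcongb Tcongb_refl Tcongb_sym Tcongb_trans.

Definition talented := {eq_quot Tcong_equiv}.

HB.instance Definition _ := Choice.on talented.
HB.instance Definition _ := EqQuotient.on talented.

Lemma piT_eq (s t : word) : \pi_talented s = \pi_talented t <-> Tcong s t.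
Proof.
split=> [/eqP | st]; first by rewrite eqmodE => /asboolP.
by apply/eqP; rewrite eqmodE; apply/asboolP.
Qed.

Lemma Tcong_repr (s : word) : Tcong (repr (\pi_talented s)) s.
Proof. by apply/piT_eq; rewrite reprK. Qed.

Definition addT (x y : talented) : talented :=
  \pi_talented (repr x ++ repr y).

Lemma addT_pi (s t : word) :
  addT (\pi_talented s) (\pi_talented t) = \pi_talented (s ++ t).
Proof. by apply/piT_eq; apply: Tcong_cat; apply: Tcong_repr. Qed.

Lemma addTA : associative addT.
Proof.
elim/quotW=> x; elim/quotW=> y; elim/quotW=> z.
by rewrite (addT_pi y z) (addT_pi x y) !addT_pi catA.
Qed.

Lemma addTC : commutative addT.
Proof.
elim/quotW=> x; elim/quotW=> y; rewrite !addT_pi.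
by apply/piT_eq/Tcong_perm; rewrite perm_catC.
Qed.

Lemma add0T : left_id (\pi_talented [::]) addT.
Proof. by elim/quotW=> x; rewrite addT_pi. Qed.

HB.instance Definition _ := GRing.isNmodule.Build talented addTA addTC add0T.

(* The generator v(n). *)
Definition gen (v : vert L) (n : 'rV[int]_k) : talented :=
  \pi_talented [:: (v, n)].

Definition shift_word (q : 'rV[int]_k) (s : word) : word :=
  [seq (p.1, p.2 + q) | p <- s].

Lemma Tcong_shift q s t :
  Tcong s t -> Tcong (shift_word q s) (shift_word q t).
Proof.
elim=> {s t} [s t st | v n m l ul le | s s' t t' _ IHs _ IHt
             | s t _ IH | s t u _ IHs _ IHt].
- exact/Tcong_perm/perm_map.
- rewrite /shift_word /src_word -map_comp /=.
  under eq_map => a do rewrite /= addrAC.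
  exact: Tcong_rel.
- by rewrite /shift_word !map_cat; apply: Tcong_cat.
- exact: Tcong_sym.
- exact: Tcong_trans IHt.
Qed.

(* The action of q on T_Λ. *)
Definition actT (q : 'rV[int]_k) (x : talented) : talented :=
  \pi_talented (shift_word q (repr x)).

Lemma actT_pi q (s : word) :
  actT q (\pi_talented s) = \pi_talented (shift_word q s).
Proof. exact/piT_eq/Tcong_shift/Tcong_repr. Qed.

Lemma actT_gen q v n : actT q (gen v n) = gen v (n + q).
Proof. exact: actT_pi. Qed.

Lemma actTD q : {morph actT q : x y / x + y}.
Proof.
elim/quotW=> x; elim/quotW=> y.
by rewrite [_ + _]addT_pi !actT_pi [RHS]addT_pi /shift_word map_cat.
Qed.

Lemma pi_sum (s : word) : \pi_talented s = \sum_(p <- s) gen p.1 p.2.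
Proof.
elim: s => [|[v n] s IHs]; first by rewrite big_nil.
by rewrite big_cons -IHs [RHS]addT_pi.
Qed.

Lemma gen_rel v n m : finite_set (paths_from v m) ->
  gen v n = \sum_(a <- fset_set (paths_from v m)) gen (src a) (n + zvec m).
Proof.
move=> fin; transitivity
    (\pi_talented (src_word (fset_set (paths_from v m)) (n + zvec m))).
  by apply/piT_eq/Tcong_rel; [exact: fset_uniq | exact: fset_setK].
by rewrite pi_sum big_map.
Qed.

Definition algle (x y : talented) : Prop := exists z, y = x + z.

Definition order_ideal (J : set talented) : Prop :=
  [/\ J 0,
      (forall x y, J x -> J y -> J (x + y)),
      (forall x y, algle x y -> J y -> J x)
    & (forall q x, J x -> J (actT q x))].

Definition prime_ideal (P : set talented) : Prop :=
  [/\ order_ideal P, P <> setT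
    & forall J1 J2, order_ideal J1 -> order_ideal J2 ->
        J1 `&` J2 `<=` P -> J1 `<=` P \/ J2 `<=` P].

Definition Spec : set (set talented) := [set P | prime_ideal P].

Definition ideal_of (H : set (vert L)) : set talented :=
  smallest order_ideal [set gen v 0 | v in H].

Definition verts_of (J : set talented) : set (vert L) := [set v | J (gen v 0)].

Definition phi (M : set (vert L)) : set talented := ideal_of (~` M).

Definition psi (J : set talented) : set (vert L) := ~` verts_of J.

End KGraphTheory.

Arguments maximal_tails {k} L _.
Arguments Spec {k} L _.

(* Main.v *)
Require Import Defs.
From HB Require Import structures.
From mathcomp Require Import all_boot all_order all_algebra.
From mathcomp Require Import finmap all_classical.
Local Open Scope classical_set_scope.

(* Call a set of vertices closed when it is hereditary and saturated.  The
   defining relations of the talented monoid respect the property "every letter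
   of the word lies in H" exactly when H is closed, so order ideals correspond
   to closed sets H through J = { words with all letters in H }.  Complements of
   closed sets are the sets with (MT1) and (MT2), and (MT3) is then primality. *)

Set Implicit Arguments.
Unset Strict Implicit.
Unset Printing Implicit Defensive.

Import GRing.Theory.
Local Open Scope ring_scope.
Local Open Scope quotient_scope.

Section Correspondence.
Variables (k : nat) (L : kgraph k).
Implicit Types (v w : vert L) (a b : mor L) (m n : 'rV[nat]_k)
  (H M : set (vert L)) (J : set (talented L)) (s t : word L).

(** * Closed sets of vertices, paths, and words *)

Definition hereditary H : Prop :=
  forall v w, paths_between v w !=set0 -> H v -> H w.

(** All degrees [m] are allowed, to match the defining relations; [maximal_tail_exit] bridges the
    gap to (MT2), which speaks only of the generators. *)
Definition saturated H : Prop :=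
  forall v m, (forall a, paths_from v m a -> H (src a)) -> H v.

Definition closed_verts H : Prop := hereditary H /\ saturated H.

Definition letters_in H s : Prop := forall p, p \in s -> H p.1.

Definition reaches (v w : vert L) : Prop := paths_between v w !=set0.

Lemma reaches_refl v : reaches v v.
Proof. by exists (idm v); split; [exact: rng_idm | exact: src_idm]. Qed.

Lemma reaches_trans v u w : reaches u v -> reaches v w -> reaches u w.
Proof.
move=> [a [ra sa]] [b [rb sb]].
have ab : src a = rng b by rewrite sa rb.
by exists (cmpm a b); split; rewrite ?rng_cmpm ?src_cmpm.
Qed.

Lemma paths_from_cmpm v m n a b :
  paths_from v m a -> paths_from (src a) n b -> paths_from v (m + n) (cmpm a b).
Proof.
move=> [da ra] [db rb].
by split; rewrite ?deg_cmpm ?rng_cmpm // da db.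
Qed.

Lemma paths_from_split v m n a : paths_from v (m + n) a ->
  exists2 b, paths_from v m b & reaches (src b) (src a).
Proof.
move=> [da ra]; have [[b c] [[/= bc db dc aE] _]] := factorization da.
exists b; last by exists c; rewrite aE src_cmpm.
by split=> //; rewrite -ra aE rng_cmpm.
Qed.

Lemma letters_in_cat H s t :
  letters_in H (s ++ t) <-> letters_in H s /\ letters_in H t.
Proof.
split=> [st | [Hs Ht] p]; last by rewrite mem_cat => /orP[/Hs|/Ht].
by split=> p ps; apply: st; rewrite mem_cat ps ?orbT.
Qed.

Lemma letters_in_shift H q s : letters_in H s -> letters_in H (shift_word q s).
Proof. by move=> Hs _ /mapP[p ps ->]; exact: Hs ps. Qed.

Lemma Tcong_letters_in H s t : closed_verts H ->
  Tcong s t -> letters_in H s <-> letters_in H t.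
Proof.
move=> [her sat]; elim=> {s t} [s t st | v n m l _ lE
    | s s' t t' _ IHs _ IHt | s t _ IH | s t u _ IHs _ IHt].
- by split=> Hs p; [rewrite -(perm_mem st) | rewrite (perm_mem st)]; apply: Hs.
- split=> [Hv _ /mapP[a al ->] /= | Hl p].
    have /Hv : (v, n) \in [:: (v, n)] by rewrite inE.
    apply: her; exists a; split=> //.
    by have [] : paths_from v m a by rewrite -lE.
  rewrite inE => /eqP-> /=; apply: (sat v m) => a; rewrite -lE => al.
  by apply: (Hl (src a, n + zvec m)); apply/mapP; exists a.
- by rewrite !letters_in_cat IHs IHt.
- by rewrite IH.
- by rewrite IHs.
Qed.

(** * Order ideals and closed sets *)

Lemma ideal_ofE H s : closed_verts H ->
  ideal_of H (\pi_(talented L) s) <-> letters_in H s.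
Proof.
move=> cH; split=> [|Hs J [[J0 JD _ Jact] JH]]; last first.
  rewrite pi_sum big_seq; apply: (big_ind J) => // -[v n] /Hs Hv /=.
  by rewrite -[n]add0r -actT_gen; apply/Jact/JH; exists v.
(* This order ideal contains the generators, so it bounds the smallest one from above; [JE] frees it
   from the choice of representative. *)
pose J := [set x : talented L | letters_in H (repr x)].
have JE t : J (\pi_(talented L) t) <-> letters_in H t.
  exact: Tcong_letters_in (Tcong_repr t).
move=> /(_ J) Hs; apply/JE; apply: Hs; split; last first.
  by move=> _ [v Hv <-]; apply/JE => p; rewrite inE => /eqP->.
split.
- exact/JE.
- by move=> x y Jx Jy; apply/JE/letters_in_cat.
- by move=> x _ [z ->] /JE/letters_in_cat[].
- by move=> q x Jx; apply/JE; apply: letters_in_shift.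
Qed.

Lemma order_ideal_ideal_of H : order_ideal (ideal_of H).
Proof.
split.
- by move=> J [[]].
- move=> x y Jx Jy J JH; case: (JH) => -[_ JD _ _] _.
  exact: JD (Jx J JH) (Jy J JH).
- by move=> x y xy Jy J JH; case: (JH) => -[_ _ Jle _] _; exact: Jle xy (Jy J JH).
- by move=> q x Jx J JH; case: (JH) => -[_ _ _ Jact] _; exact: Jact (Jx J JH).
Qed.

Lemma verts_ofK H : closed_verts H -> verts_of (ideal_of H) = H.
Proof.
move=> cH; apply/seteqP; split=> v /=.
  by move=> /(ideal_ofE _ cH) /(_ (v, 0)); apply; rewrite inE.
by move=> Hv; apply/(ideal_ofE _ cH) => p; rewrite inE => /eqP->.
Qed.

Lemma order_ideal_gen J v (n : 'rV[int]_k) :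
  order_ideal J -> J (gen v n) <-> verts_of J v.
Proof.
move=> [_ _ _ Jact]; split=> [/(Jact (- n))|/(Jact n)]; rewrite actT_gen.
  by rewrite subrr.
by rewrite add0r.
Qed.

(** Each summand is below the sum, so a down-set containing the sum contains every summand. *)
Lemma order_idealE J s : order_ideal J ->
  J (\pi_(talented L) s) <-> letters_in (verts_of J) s.
Proof.
move=> oJ; have [J0 JD Jle _] := oJ; rewrite pi_sum; split=> [Js p ps | Hs].
  apply/(order_ideal_gen _ p.2 oJ); apply: Jle Js.
  by rewrite (perm_big _ (perm_to_rem ps)) big_cons; eexists.
by rewrite big_seq; apply: (big_ind J) => // p /Hs /(order_ideal_gen _ p.2 oJ).
Qed.

Hypothesis Lfin : row_finite L.

(** Row-finiteness writes [gen v 0] as a finite sum over the paths from [v] of a given degree: its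
    summands lie below it (hereditary), and it lies in [J] once they all do (saturated). *)
Lemma closed_verts_of J : order_ideal J -> closed_verts (verts_of J).
Proof.
move=> oJ; have [J0 JD Jle _] := oJ; split=> [v w [a [ra <-]] Jv | v m Jm].
  apply/(order_ideal_gen _ (0 + zvec (deg a)) oJ); apply: Jle Jv.
  rewrite (gen_rel 0 (Lfin v (deg a))).
  have al : a \in fset_set (paths_from v (deg a)).
    by rewrite in_fset_set ?inE; last exact: Lfin.
  by rewrite (perm_big _ (perm_to_rem al)) big_cons; eexists.
rewrite /verts_of /= (gen_rel 0 (Lfin v m)) big_seq.
apply: (big_ind J) => // a; rewrite in_fset_set ?inE; last exact: Lfin.
by move=> /Jm Ja; apply/order_ideal_gen.
Qed.

Lemma ideal_ofK J : order_ideal J -> ideal_of (verts_of J) = J.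
Proof.
move=> oJ; have cJ := closed_verts_of oJ.
apply/seteqP; split; elim/quotW => s.
  by move=> /(ideal_ofE _ cJ)/(order_idealE _ oJ).
by move=> /(order_idealE _ oJ)/(ideal_ofE _ cJ).
Qed.

(** * Maximal tails and prime ideals *)

Lemma maximal_tail_exit M v m : maximal_tail M -> M v ->
  exists2 a, paths_from v m a & M (src a).
Proof.
move=> [_ _ MT2 _]; move: v.
(* Induction on the total degree of [m], taking one edge by (MT2) at each step. *)
have [d md] : exists d : nat, (\sum_i m ord0 i)%N = d by eexists.
elim: d m md => [|d IHd] m md v Mv.
  have -> : m = 0.
    move/eqP: md; rewrite sum_nat_eq0 => /forallP m0.
    by apply/rowP => i; rewrite mxE; apply/eqP/m0.
  by exists (idm v); rewrite ?src_idm //; split; rewrite ?deg_idm ?rng_idm.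
have [i mi] : exists i, (0 < m ord0 i)%N.
  apply/existsP; apply: contra_eqT md => /existsPn m0.
  by rewrite big1 // => i _; apply/eqP; rewrite eqn0Ngt.
(* The truncated subtraction is exact because coordinate [i] of [m] is positive. *)
pose m' : 'rV[nat]_k := \row_(j < k) (m ord0 j - (j == i))%N.
have mE : m = delta_mx 0 i + m'.
  apply/rowP => j; rewrite !mxE eqxx /=.
  case: eqP => [->|_]; last by rewrite subn0 add0r.
  by case: (m 0 i) mi => // p _; rewrite subn1.
have [a va Ma] := MT2 v i Mv.
have m'd : (\sum_j m' ord0 j)%N = d.
  apply/eq_add_S; rewrite -md (bigD1 i) //= [RHS](bigD1 i) //=.
  rewrite !mxE eqxx -addSn subn1 prednK //; congr addn.
  by apply: eq_bigr => j /negPf ji; rewrite !mxE ji subn0.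
have [b ab Mb] := IHd m' m'd _ Ma.
exists (cmpm a b); first by rewrite mE; apply: paths_from_cmpm.
by case: ab => _ /esym/src_cmpm->.
Qed.

Lemma maximal_tail_closed M : maximal_tail M -> closed_verts (~` M).
Proof.
move=> tM; have [_ MT1 _ _] := tM; split=> [v w vw Nv Mw | v m Nm Mv].
  exact: Nv (MT1 _ _ Mw vw).
by have [a /Nm] := maximal_tail_exit m tM Mv.
Qed.

Lemma psiK M : maximal_tail M -> psi (phi M) = M.
Proof. by rewrite /psi /phi => /maximal_tail_closed/verts_ofK ->; rewrite setCK. Qed.

Lemma phiK J : order_ideal J -> phi (psi J) = J.
Proof. by move=> oJ; rewrite /phi /psi setCK ideal_ofK. Qed.

Lemma phi_prime M : maximal_tail M -> prime_ideal (phi M).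
Proof.
move=> tM; have [[v Mv] _ _ MT3] := tM.
have cM := maximal_tail_closed tM.
have witness J : order_ideal J -> ~ (J `<=` phi M) ->
    exists2 u, M u & verts_of J u.
  move=> oJ NJ; apply: contrapT => NM; apply: NJ; elim/quotW => s.
  move=> /(order_idealE _ oJ) Js; apply/(ideal_ofE _ cM) => p /Js Jp Mp.
  by apply: NM; exists p.1.
split; first exact: order_ideal_ideal_of.
  (* If [phi M] were everything, [M = psi (phi M)] would be empty. *)
  by move=> PT; have := psiK tM; rewrite PT => ME; move: Mv; rewrite -ME; apply.
move=> J1 J2 o1 o2 J12; apply: contrapT => /not_orP[/(witness _ o1)[u1 M1 J1u]].
move=> /(witness _ o2)[u2 M2 J2u].
(* Heredity puts [w] in both ideals, hence in [phi M], against [M w]. *)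
have [w Mw [u1w u2w]] := MT3 _ _ M1 M2.
have [her1 _] := closed_verts_of o1; have [her2 _] := closed_verts_of o2.
have : verts_of (phi M) w.
  by apply: J12; split; [exact: her1 J1u | exact: her2 J2u].
by rewrite verts_ofK.
Qed.

(* For H closed, a closed set containing u, all of whose vertices outside H
   reach, outside H, a vertex reachable from u.  It replaces the saturation of
   the hereditary closure of u, and is closed without a finiteness argument. *)
Definition cofinal_to H u : set (vert L) :=
  [set w | forall x, reaches w x -> ~ H x ->
     exists y, [/\ reaches x y, reaches u y & ~ H y]].

Lemma cofinal_to_closed H u : closed_verts H -> closed_verts (cofinal_to H u).
Proof.
move=> [her sat]; split=> [v w vw Hv x wx | v m Hm x [a [ra <-]] Nx].
  exact: Hv (reaches_trans vw wx).
have [b xb Nb] : exists2 b, paths_from (src a) m b & ~ H (src b).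
  apply: contrapT => Nb; apply: Nx; apply: (sat _ m) => b xb.
  by apply: contrapT => Hb; apply: Nb; exists b.
have va : paths_from v (m + deg a) (cmpm a b).
  by rewrite addrC; apply: paths_from_cmpm.
have [c vc] := paths_from_split va.
have [_ rb] := xb; rewrite src_cmpm // => cb.
have [y [xy uy Ny]] := Hm c vc _ cb Nb.
by exists y; split=> //; apply: reaches_trans xy; exists b.
Qed.

Lemma psi_maximal_tail J : prime_ideal J -> maximal_tail (psi J).
Proof.
move=> [oJ JT Jprime]; have cJ := closed_verts_of oJ; have [her sat] := cJ.
split.
- apply: contrapT => J0; apply: JT; apply/seteqP; split=> //; elim/quotW => s _.
  apply/(order_idealE _ oJ) => p _; apply: contrapT => Np.
  by apply: J0; exists p.1.
- by move=> w v Nw vw Hv; exact: Nw (her _ _ vw Hv).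
- move=> v i Nv; apply: contrapT => Ni; apply: Nv; apply: (sat _ (delta_mx 0 i)).
  by move=> a va; apply: contrapT => Na; apply: Ni; exists a.
- move=> u v Nu Nv.
  pose C w := cofinal_to (verts_of J) w.
  have cC w : closed_verts (C w) by exact: cofinal_to_closed.
  (* [w] belongs to [C w]: any vertex reached from [w] serves as its own [y]. *)
  have NC w : ~ verts_of J w -> ~ (ideal_of (C w) `<=` J).
    move=> Nw CJ; apply/Nw/CJ; rewrite -[ideal_of _ _]/(verts_of _ w) verts_ofK //.
    by move=> x wx Nx; exists x; split=> //; exact: reaches_refl.
  have NI : ~ (ideal_of (C u) `&` ideal_of (C v) `<=` J).
    move=> /(Jprime _ _ (order_ideal_ideal_of _) (order_ideal_ideal_of _)).
    by case; apply: NC.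
  have [w [Cu Cv] Nw] : exists2 w, C u w /\ C v w & ~ verts_of J w.
    apply: contrapT => NE; apply: NI; elim/quotW => s.
    move=> [/(ideal_ofE _ (cC u)) su /(ideal_ofE _ (cC v)) sv].
    apply/(order_idealE _ oJ) => p ps; apply: contrapT => Np.
    by apply: NE; exists p.1 => //; split; [exact: su | exact: sv].
  (* Cofinality is used twice: [y] is reached from [w] and [u], then [z] from [y] and [v], so [u]
     reaches [z] through [y]. *)
  have [y [wy uy Ny]] := Cu w (reaches_refl w) Nw.
  have [z [yz vz Nz]] := Cv y wy Ny.
  by exists z => //; split=> //; exact: reaches_trans yz.
Qed.

(** Fewer generators give a smaller ideal; the converse follows by applying the order-reversing
    [psi]. *)
Lemma phi_le M N : maximal_tail M -> maximal_tail N ->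
  M `<=` N <-> phi N `<=` phi M.
Proof.
move=> tM tN; split=> [MN x Nx J [oJ HJ] | NM].
  apply: Nx; split=> // _ [v Nv <-]; apply: HJ; exists v => //.
  by move=> /MN.
by rewrite -(psiK tM) -(psiK tN); apply: subsetC => v /NM.
Qed.

End Correspondence.

Theorem theorem5p3 (k : nat) (k_gt0 : (0 < k)%N) (L : kgraph k)
    (Lfin : row_finite L) (Lsrc : no_sources L) :
  [/\ set_bij (maximal_tails L) (Spec L) (@phi k L),
      (forall M N : set (vert L), maximal_tails L M -> maximal_tails L N ->
         (M `<=` N <-> phi N `<=` phi M)),
      set_fun (Spec L) (maximal_tails L) (@psi k L),
      (forall M, maximal_tails L M -> psi (phi M) = M)
    & (forall J, Spec L J -> phi (psi J) = J)].
Proof.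
have psi_tail J : Spec L J -> maximal_tails L (psi J) by exact: psi_maximal_tail.
have phi_psi J : Spec L J -> phi (psi J) = J by case=> oJ _ _; exact: phiK.
split=> //; [split | exact: phi_le | exact: psiK].
- by move=> M; exact: phi_prime.
- by move=> M N /set_mem tM /set_mem tN MN; rewrite -(psiK tM) MN psiK.
- by move=> J JS; exists (psi J); [exact: psi_tail | exact: phi_psi].
Qed.
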